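(* Let $A$ be an associative unital ring and let $B$ be a separable $A$-ring. Then $B$ is a coseparable non-counital $A$-coring, i.e. the $(A,A)$-bimodule $B$ admits a coproduct $\Delta:B\to B\otimes_A B$ making it a coseparable non-counital $A$-coring.
   Context: $A$ is an associative ring with unit. An $A$-ring is an $(A,A)$-bimodule $B$ with an $(A,A)$-bimodule map $\mu:B\otimes_A B\to B$ which is associative, $\mu\circ(\mu\otimes I)=\mu\circ(I\otimes\mu)$ (no unit is required). An $A$-ring $B$ is separable if there is a $(B,B)$-bimodule map $\delta:B\to B\otimes_A B$ with $\mu\circ\delta=I_B$, where $B\otimes_A B$ has left $B$-action $\mu\otimes I$ and right $B$-action $I\otimes\mu$ (modules over an $A$-ring are $A$-modules and their morphisms are $A$-linear, so $\delta$ is in particular $(A,A)$-bilinear). A non-counital $A$-coring is an $(A,A)$-bimodule $\mathcal{C}$ with an $(A,A)$-bimodule map $\Delta_{\mathcal{C}}:\mathcal{C}\to\mathcal{C}\otimes_A\mathcal{C}$ (coproduct) such that $(\Delta_{\mathcal{C}}\otimes I)\circ\Delta_{\mathcal{C}}=(I\otimes\Delta_{\mathcal{C}})\circ\Delta_{\mathcal{C}}$. $\mathcal{C}$ is a (non-counital) $(\mathcal{C},\mathcal{C})$-bicomodule via $\Delta_{\mathcal{C}}$, and $\mathcal{C}\otimes_A\mathcal{C}$ is one with left coaction $\Delta_{\mathcal{C}}\otimes I$ and right coaction $I\otimes\Delta_{\mathcal{C}}$. A non-counital coring $\mathcal{C}$ is coseparable if there is a $(\mathcal{C},\mathcal{C})$-bicomodule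 map $\pi:\mathcal{C}\otimes_A\mathcal{C}\to\mathcal{C}$ with $\pi\circ\Delta_{\mathcal{C}}=I_{\mathcal{C}}$. *)

(* Defs.v *)
From HB Require Import structures.
From mathcomp Require Import all_boot ssralg ssrint generic_quotient ring_quotient.
From mathcomp Require Import freeg.
From mathcomp Require Import boolp.

Set Implicit Arguments.
Unset Strict Implicit.
Unset Printing Implicit Defensive.

Import GRing.Theory Quotient.

Local Open Scope ring_scope.
Local Open Scope quotient_scope.

Reserved Notation "M ⊗ N" (at level 40, left associativity).
Reserved Notation "{ 'bimod' M -> N }"
  (at level 0, M at level 98, N at level 99, format "{ 'bimod'  M  ->  N }").

(* The left action is that of the underlying lmodType; the right one is       *)
(* rscale. It is not an lmodType over A^c, since a type can carry only one    *)
(* canonical lmodType structure.                                              *)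
HB.mixin Record Lmodule_isBimodule (A : pzRingType) M of GRing.Lmodule A M := {
  rscale : M -> A -> M;
  rscaleA : forall x a b, rscale (rscale x a) b = rscale x (a * b);
  rscale1 : forall x, rscale x 1 = x;
  rscaleDl : forall a x y, rscale (x + y) a = rscale x a + rscale y a;
  rscaleDr : forall x a b, rscale x (a + b) = rscale x a + rscale x b;
  scale_rscale : forall a x b, a *: rscale x b = rscale (a *: x) b
}.

#[short(type="bimodType")]
HB.structure Definition Bimodule (A : pzRingType) :=
  {M of Lmodule_isBimodule A M & GRing.Lmodule A M}.

Lemma rscaleB (A : pzRingType) (M : bimodType A) (x y : M) (a : A) :
  rscale (x - y) a = rscale x a - rscale y a.
Proof.
have r0 : rscale (0 : M) a = 0.
  by apply: (addrI (rscale 0 a)); rewrite -rscaleDl !addr0.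
have rN v : rscale (- v : M) a = - rscale v a.
  by apply: (addrI (rscale v a)); rewrite -rscaleDl !subrr.
by rewrite rscaleDl rN.
Qed.

HB.mixin Record isRScalable (A : pzRingType) (M N : bimodType A)
    (f : M -> N) := {
  rscalable_subproof : forall x a, f (rscale x a) = rscale (f x) a
}.

#[short(type="bimodMap")]
HB.structure Definition BimodMap (A : pzRingType) (M N : bimodType A) :=
  {f of isRScalable A M N f & @GRing.Linear A M N *:%R f}.

Notation "{ 'bimod' M -> N }" := (bimodMap M%type N%type) : type_scope.

Lemma bimodZr (A : pzRingType) (M N : bimodType A) (f : {bimod M -> N}) x a :
  f (rscale x a) = rscale (f x) a.
Proof. exact: rscalable_subproof. Qed.

Section BimodMapTheory.
Variables (A : pzRingType) (M N P : bimodType A).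

HB.instance Definition _ := isRScalable.Build A M M idfun (fun x a => erefl).

Lemma comp_rscalable (g : {bimod N -> P}) (f : {bimod M -> N}) x a :
  (g \o f) (rscale x a) = rscale ((g \o f) x) a.
Proof. by rewrite /= (bimodZr f) (bimodZr g). Qed.

HB.instance Definition _ (g : {bimod N -> P}) (f : {bimod M -> N}) :=
  isRScalable.Build A M P (g \o f) (comp_rscalable g f).

End BimodMapTheory.

(* The tensor product over A is the quotient of the free abelian group on     *)
(* M * N by the subgroup generated by the usual three families of relators.   *)
Section Tensor.
Variables (A : pzRingType) (M N : bimodType A).

Inductive tensor_relator : {freeg (M * N)%type} -> Prop :=
| TensorRel0 : tensor_relator 0
| TensorRelB u v :
    tensor_relator u -> tensor_relator v -> tensor_relator (u - v)
| TensorRelDl x x' y :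
    tensor_relator (<<(x + x', y)>> - <<(x, y)>> - <<(x', y)>>)
| TensorRelDr x y y' :
    tensor_relator (<<(x, y + y')>> - <<(x, y)>> - <<(x, y')>>)
| TensorRelM x a y :
    tensor_relator (<<(rscale x a, y)>> - <<(x, a *: y)>>).

Definition tensor_rel : pred {freeg (M * N)%type} :=
  fun u => `[< tensor_relator u >].

Lemma tensor_rel_zmod : zmod_closed tensor_rel.
Proof.
split=> [|u v]; first by apply/asboolP; exact: TensorRel0.
by move=> /asboolP ru /asboolP rv; apply/asboolP; exact: TensorRelB.
Qed.

HB.instance Definition _ := GRing.isZmodClosed.Build _ tensor_rel tensor_rel_zmod.

Definition tensor : Type :=
  {quot (GRing.ZmodClosed.clone _ tensor_rel _)}.

HB.instance Definition _ := GRing.Zmodule.on tensor.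
HB.instance Definition _ := EqQuotient.on tensor.
HB.instance Definition _ := ZmodQuotient.on tensor.

Definition pure (x : M) (y : N) : tensor :=
  \pi_tensor <<(x, y)>>.

Record balanced (G : zmodType) (f : M -> N -> G) : Prop := Balanced {
  balancedDl : forall x x' y, f (x + x') y = f x y + f x' y;
  balancedDr : forall x y y', f x (y + y') = f x y + f x y';
  balancedM : forall x a y, f (rscale x a) y = f x (a *: y)
}.

Definition free_lift (G : zmodType) (f : M -> N -> G) :
    {freeg (M * N)%type} -> G :=
  fglift (fun p => f p.1 p.2 : zmodule G).

(* Total in f; well defined and additive only when f is balanced.             *)
Definition tlift (G : zmodType) (f : M -> N -> G) (t : tensor) : G :=
  free_lift f (repr t).

Lemma free_lift_zmod_morphism (G : zmodType) (f : M -> N -> G) :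
  zmod_morphism (free_lift f).
Proof. exact: (@lift_is_additive _ _ (zmodule G)). Qed.

HB.instance Definition _ (G : zmodType) (f : M -> N -> G) :=
  GRing.isZmodMorphism.Build _ _ (free_lift f) (free_lift_zmod_morphism f).

Lemma free_liftE (G : zmodType) (f : M -> N -> G) x y :
  free_lift f <<(x, y)>> = f x y.
Proof. by rewrite /free_lift liftU scale1r. Qed.

Lemma tensor_piP u v : \pi_tensor u = \pi_tensor v <-> tensor_relator (u - v).
Proof.
split=> [/eqP|r]; last apply/eqP.
  by rewrite -[_ == _]idealrBE => /asboolP.
by rewrite -[_ == _]idealrBE; apply/asboolP.
Qed.

Lemma pureDl x x' y : pure (x + x') y = pure x y + pure x' y.
Proof.
rewrite /pure -[RHS]raddfD; apply/tensor_piP; rewrite opprD addrA.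
exact: TensorRelDl.
Qed.

Lemma pureDr x y y' : pure x (y + y') = pure x y + pure x y'.
Proof.
rewrite /pure -[RHS]raddfD; apply/tensor_piP; rewrite opprD addrA.
exact: TensorRelDr.
Qed.

Lemma pureBl x x' y : pure (x - x') y = pure x y - pure x' y.
Proof. by apply/eqP; rewrite eq_sym subr_eq -pureDl subrK. Qed.

Lemma pureBr x y y' : pure x (y - y') = pure x y - pure x y'.
Proof. by apply/eqP; rewrite eq_sym subr_eq -pureDr subrK. Qed.

Lemma pureM x a y : pure (rscale x a) y = pure x (a *: y).
Proof. by apply/tensor_piP; exact: TensorRelM. Qed.

Lemma tlift_pi (G : zmodType) (f : M -> N -> G) : balanced f ->
  forall u, tlift f (\pi_tensor u) = free_lift f u.
Proof.
move=> [fDl fDr fM] u; apply/eqP; rewrite -subr_eq0 -raddfB /=; apply/eqP.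
have: tensor_relator (repr (\pi_tensor u) - u) by apply/tensor_piP; rewrite reprK.
elim=> [|v w _ vP _ wP|x x' y|x y y'|x a y].
- by rewrite raddf0.
- by rewrite raddfB /= vP wP subr0.
- by rewrite !raddfB /= !free_liftE fDl -addrA -opprD subrr.
- by rewrite !raddfB /= !free_liftE fDr -addrA -opprD subrr.
- by rewrite !raddfB /= !free_liftE fM subrr.
Qed.

Lemma tliftE (G : zmodType) (f : M -> N -> G) : balanced f ->
  forall x y, tlift f (pure x y) = f x y.
Proof. by move=> fb x y; rewrite tlift_pi // free_liftE. Qed.

Lemma tlift_zmod_morphism (G : zmodType) (f : M -> N -> G) :
  balanced f -> zmod_morphism (tlift f).
Proof.
move=> fb; elim/quotW => u; elim/quotW => v.
by rewrite -raddfB /= !tlift_pi // raddfB.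
Qed.

Lemma tensor_ind (P : tensor -> Prop) :
  (forall x y, P (pure x y)) -> (forall u v, P u -> P v -> P (u - v)) ->
  forall t, P t.
Proof.
move=> Pp PB; have P0 : P 0 by rewrite -(subrr (pure 0 0)); apply: PB.
have PN u : P u -> P (- u) by rewrite -sub0r; apply: PB.
have PD u v : P u -> P v -> P (u + v) by move=> ? /PN; rewrite -{2}[v]opprK; apply: PB.
elim/quotW => u; rewrite -[u]freeg_sumE raddf_sum /=.
elim/big_ind: _ => // -[x y] _.
rewrite -(intz (coeff (x, y) u)) -freegU_mulz raddfMz /=.
have PM n : P (pure x y *+ n) by elim: n => // n IHn; rewrite mulrS; apply: PD.
by case: (coeff _ _) => n; [exact: PM | rewrite NegzE mulrNz; exact/PN/PM].
Qed.

End Tensor.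

Notation "M ⊗ N" := (tensor M%type N%type) : type_scope.

Section TensorBimodule.
Variables (A : pzRingType) (M N : bimodType A).
Implicit Types (a b : A) (x : M) (y : N) (t u : M ⊗ N).

Lemma tensor_scale_balanced a :
  balanced (fun x y => pure (a *: x) y : M ⊗ N).
Proof.
split=> [x x' y|x y y'|x b y]; first by rewrite scalerDr pureDl.
  by rewrite pureDr.
by rewrite scale_rscale pureM.
Qed.

Lemma tensor_rscale_balanced a :
  balanced (fun x y => pure x (rscale y a) : M ⊗ N).
Proof.
split=> [x x' y|x y y'|x b y]; first by rewrite pureDl.
  by rewrite rscaleDl pureDr.
by rewrite pureM scale_rscale.
Qed.

Definition tensor_scale a : M ⊗ N -> M ⊗ N :=
  tlift (fun x y => pure (a *: x) y).

Definition tensor_rscale t a : M ⊗ N :=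
  tlift (fun x y => pure x (rscale y a)) t.

Lemma tensor_scaleE a x y : tensor_scale a (pure x y) = pure (a *: x) y.
Proof. exact/tliftE/tensor_scale_balanced. Qed.

Lemma tensor_rscaleE a x y : tensor_rscale (pure x y) a = pure x (rscale y a).
Proof. exact/tliftE/tensor_rscale_balanced. Qed.

Lemma tensor_scaleB a t u :
  tensor_scale a (t - u) = tensor_scale a t - tensor_scale a u.
Proof. exact/tlift_zmod_morphism/tensor_scale_balanced. Qed.

Lemma tensor_rscaleB a t u :
  tensor_rscale (t - u) a = tensor_rscale t a - tensor_rscale u a.
Proof. exact/tlift_zmod_morphism/tensor_rscale_balanced. Qed.

Lemma tensor_scaleA a b t :
  tensor_scale a (tensor_scale b t) = tensor_scale (a * b) t.
Proof.
elim/tensor_ind: t => [x y|t u IHt IHu]; last by rewrite !tensor_scaleB IHt IHu.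
by rewrite !tensor_scaleE scalerA.
Qed.

Lemma tensor_scale1 t : tensor_scale 1 t = t.
Proof.
elim/tensor_ind: t => [x y|t u IHt IHu]; last by rewrite tensor_scaleB IHt IHu.
by rewrite tensor_scaleE scale1r.
Qed.

Lemma tensor_scaleDr a t u :
  tensor_scale a (t + u) = tensor_scale a t + tensor_scale a u.
Proof.
have N0 v : tensor_scale a (- v) = - tensor_scale a v.
  have:= tensor_scaleB a v v; rewrite subrr => a0.
  by rewrite -sub0r tensor_scaleB a0 subrr sub0r.
by rewrite -[u in LHS]opprK tensor_scaleB N0 opprK.
Qed.

Lemma tensor_scaleDl t a b :
  tensor_scale (a + b) t = tensor_scale a t + tensor_scale b t.
Proof.
elim/tensor_ind: t => [x y|t u IHt IHu].
  by rewrite !tensor_scaleE scalerDl pureDl.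
by rewrite !tensor_scaleB IHt IHu opprD addrACA.
Qed.

HB.instance Definition _ := GRing.Zmodule_isLmodule.Build A (M ⊗ N)
  tensor_scaleA tensor_scale1 tensor_scaleDr tensor_scaleDl.

Lemma tensor_rscaleA t a b :
  tensor_rscale (tensor_rscale t a) b = tensor_rscale t (a * b).
Proof.
elim/tensor_ind: t => [x y|t u IHt IHu]; last by rewrite !tensor_rscaleB IHt IHu.
by rewrite !tensor_rscaleE rscaleA.
Qed.

Lemma tensor_rscale1 t : tensor_rscale t 1 = t.
Proof.
elim/tensor_ind: t => [x y|t u IHt IHu]; last by rewrite tensor_rscaleB IHt IHu.
by rewrite tensor_rscaleE rscale1.
Qed.

Lemma tensor_rscaleDl a t u :
  tensor_rscale (t + u) a = tensor_rscale t a + tensor_rscale u a.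
Proof.
have N0 v : tensor_rscale (- v) a = - tensor_rscale v a.
  have:= tensor_rscaleB a v v; rewrite subrr => a0.
  by rewrite -sub0r tensor_rscaleB a0 subrr sub0r.
by rewrite -[u in LHS]opprK tensor_rscaleB N0 opprK.
Qed.

Lemma tensor_rscaleDr t a b :
  tensor_rscale t (a + b) = tensor_rscale t a + tensor_rscale t b.
Proof.
elim/tensor_ind: t => [x y|t u IHt IHu].
  by rewrite !tensor_rscaleE rscaleDr pureDr.
by rewrite !tensor_rscaleB IHt IHu opprD addrACA.
Qed.

Lemma tensor_scale_rscale a t b :
  a *: tensor_rscale t b = tensor_rscale (a *: t) b.
Proof.
rewrite /GRing.scale /=.
elim/tensor_ind: t => [x y|t u IHt IHu].
  by rewrite tensor_scaleE !tensor_rscaleE tensor_scaleE.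
by rewrite !(tensor_scaleB, tensor_rscaleB) IHt IHu.
Qed.

HB.instance Definition _ := Lmodule_isBimodule.Build A (M ⊗ N)
  tensor_rscaleA tensor_rscale1 tensor_rscaleDl tensor_rscaleDr
  tensor_scale_rscale.

Lemma scale_pure a x y : a *: (pure x y : M ⊗ N) = pure (a *: x) y.
Proof. exact: tensor_scaleE. Qed.

Lemma rscale_pure x y a : rscale (pure x y : M ⊗ N) a = pure x (rscale y a).
Proof. exact: tensor_rscaleE. Qed.

Lemma tlift_scalable (P : bimodType A) (f : M -> N -> P) : balanced f ->
  (forall a x y, f (a *: x) y = a *: f x y) -> scalable (tlift f).
Proof.
move=> fb fZ a t; elim/tensor_ind: t => [x y|t u IHt IHu].
  by rewrite scale_pure !tliftE.
by rewrite scalerBr !(tlift_zmod_morphism fb) IHt IHu scalerBr.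
Qed.

Lemma tlift_rscalable (P : bimodType A) (f : M -> N -> P) : balanced f ->
  (forall x y a, f x (rscale y a) = rscale (f x y) a) ->
  forall t a, tlift f (rscale t a) = rscale (tlift f t) a.
Proof.
move=> fb fZ t a; elim/tensor_ind: t => [x y|t u IHt IHu].
  by rewrite rscale_pure !tliftE.
by rewrite rscaleB !(tlift_zmod_morphism fb) IHt IHu rscaleB.
Qed.

End TensorBimodule.

Definition tmap (A : pzRingType) (M M' N N' : bimodType A)
    (f : M -> M') (g : N -> N') : M ⊗ N -> M' ⊗ N' :=
  tlift (fun x y => pure (f x) (g y)).

Section TensorMap.
Variables (A : pzRingType) (M M' N N' : bimodType A).
Variables (f : {bimod M -> M'}) (g : {bimod N -> N'}).

Lemma tmap_balanced : balanced (fun x y => pure (f x) (g y)).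
Proof.
split=> [x x' y|x y y'|x a y]; first by rewrite raddfD pureDl.
  by rewrite raddfD pureDr.
by rewrite bimodZr linearZ pureM.
Qed.

Lemma tmapE x y : tmap f g (pure x y) = pure (f x) (g y).
Proof. exact/tliftE/tmap_balanced. Qed.

Lemma tmap_scalable : scalable (tmap f g).
Proof.
apply: tlift_scalable tmap_balanced _ => a x y.
by rewrite linearZ scale_pure.
Qed.

Lemma tmap_rscalable t a : tmap f g (rscale t a) = rscale (tmap f g t) a.
Proof.
apply: tlift_rscalable tmap_balanced _ _ _ => x y b.
by rewrite bimodZr rscale_pure.
Qed.

HB.instance Definition _ := GRing.isZmodMorphism.Build (M ⊗ N) (M' ⊗ N')
  (tmap f g) (tlift_zmod_morphism tmap_balanced).
HB.instance Definition _ := GRing.isScalable.Build A (M ⊗ N) (M' ⊗ N') *:%R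
  (tmap f g) tmap_scalable.
HB.instance Definition _ := isRScalable.Build A (M ⊗ N) (M' ⊗ N')
  (tmap f g) tmap_rscalable.

End TensorMap.

Section TensorAssoc.
Variables (A : pzRingType) (M N P : bimodType A).

Definition tassoc : (M ⊗ N) ⊗ P -> M ⊗ (N ⊗ P) :=
  tlift (fun t z => tlift (fun x y => pure x (pure y z)) t).

Definition tassocV : M ⊗ (N ⊗ P) -> (M ⊗ N) ⊗ P :=
  tlift (fun x t => tlift (fun y z => pure (pure x y) z) t).

Lemma tassoc_balanced1 (z : P) :
  balanced (fun (x : M) (y : N) => pure x (pure y z)).
Proof.
split=> [x x' y|x y y'|x a y]; first by rewrite pureDl.
  by rewrite pureDl pureDr.
by rewrite pureM scale_pure.
Qed.

Lemma tassoc_balanced :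
  balanced (fun t (z : P) => tlift (fun (x : M) (y : N) => pure x (pure y z)) t).
Proof.
have B z := tlift_zmod_morphism (tassoc_balanced1 z).
split=> [t t' z|t z z'|t a z].
- pose F : {additive M ⊗ N -> M ⊗ (N ⊗ P)} :=
    HB.pack (tlift (fun x y => pure x (pure y z)))
      (GRing.isZmodMorphism.Build _ _ _ (B z)).
  exact: (raddfD F).
- elim/tensor_ind: t => [x y|t u IHt IHu]; last by rewrite !B IHt IHu opprD addrACA.
  by rewrite !(tliftE (tassoc_balanced1 _)) !pureDr.
- elim/tensor_ind: t => [x y|t u IHt IHu]; last by rewrite rscaleB !B IHt IHu.
  by rewrite rscale_pure !(tliftE (tassoc_balanced1 _)) pureM.
Qed.

Lemma tassocV_balanced1 (x : M) :
  balanced (fun (y : N) (z : P) => pure (pure x y) z).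
Proof.
split=> [y y' z|y z z'|y a z]; first by rewrite pureDr pureDl.
  by rewrite pureDr.
by rewrite -rscale_pure pureM.
Qed.

Lemma tassocV_balanced :
  balanced (fun (x : M) t => tlift (fun (y : N) (z : P) => pure (pure x y) z) t).
Proof.
have B x := tlift_zmod_morphism (tassocV_balanced1 x).
split=> [x x' t|x t t'|x a t].
- elim/tensor_ind: t => [y z|t u IHt IHu]; last by rewrite !B IHt IHu opprD addrACA.
  by rewrite !(tliftE (tassocV_balanced1 _)) !pureDl.
- pose F : {additive N ⊗ P -> (M ⊗ N) ⊗ P} :=
    HB.pack (tlift (fun y z => pure (pure x y) z))
      (GRing.isZmodMorphism.Build _ _ _ (B x)).
  exact: (raddfD F).
- elim/tensor_ind: t => [y z|t u IHt IHu]; last by rewrite scalerBr !B IHt IHu.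
  by rewrite scale_pure !(tliftE (tassocV_balanced1 _)) pureM.
Qed.

Lemma tassocE (x : M) (y : N) (z : P) :
  tassoc (pure (pure x y) z) = pure x (pure y z).
Proof.
by rewrite /tassoc (tliftE tassoc_balanced) (tliftE (tassoc_balanced1 z)).
Qed.

Lemma tassocVE (x : M) (y : N) (z : P) :
  tassocV (pure x (pure y z)) = pure (pure x y) z.
Proof.
by rewrite /tassocV (tliftE tassocV_balanced) (tliftE (tassocV_balanced1 x)).
Qed.

Lemma tassoc_scalable : scalable tassoc.
Proof.
apply: tlift_scalable tassoc_balanced _ => a t z.
apply: tlift_scalable (tassoc_balanced1 z) _ _ _ => b x y.
by rewrite scale_pure.
Qed.

Lemma tassoc_rscalable t a : tassoc (rscale t a) = rscale (tassoc t) a.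
Proof.
apply: tlift_rscalable tassoc_balanced _ _ _ => {}t z {}a.
have B z' := tlift_zmod_morphism (tassoc_balanced1 z').
elim/tensor_ind: t => [x y|t u IHt IHu]; last by rewrite !B IHt IHu rscaleB.
by rewrite !(tliftE (tassoc_balanced1 _)) !rscale_pure.
Qed.

Lemma tassocV_scalable : scalable tassocV.
Proof.
apply: tlift_scalable tassocV_balanced _ => a x t.
have B x' := tlift_zmod_morphism (tassocV_balanced1 x').
elim/tensor_ind: t => [y z|t u IHt IHu]; last by rewrite !B IHt IHu scalerBr.
by rewrite !(tliftE (tassocV_balanced1 _)) !scale_pure.
Qed.

Lemma tassocV_rscalable t a : tassocV (rscale t a) = rscale (tassocV t) a.
Proof.
apply: tlift_rscalable tassocV_balanced _ _ _ => x {}t {}a.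
apply: tlift_rscalable (tassocV_balanced1 x) _ _ _ => y z b.
by rewrite rscale_pure.
Qed.

HB.instance Definition _ := GRing.isZmodMorphism.Build
  ((M ⊗ N) ⊗ P) (M ⊗ (N ⊗ P)) tassoc (tlift_zmod_morphism tassoc_balanced).
HB.instance Definition _ := GRing.isScalable.Build A
  ((M ⊗ N) ⊗ P) (M ⊗ (N ⊗ P)) *:%R tassoc tassoc_scalable.
HB.instance Definition _ := isRScalable.Build A
  ((M ⊗ N) ⊗ P) (M ⊗ (N ⊗ P)) tassoc tassoc_rscalable.

HB.instance Definition _ := GRing.isZmodMorphism.Build
  (M ⊗ (N ⊗ P)) ((M ⊗ N) ⊗ P) tassocV (tlift_zmod_morphism tassocV_balanced).
HB.instance Definition _ := GRing.isScalable.Build A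
  (M ⊗ (N ⊗ P)) ((M ⊗ N) ⊗ P) *:%R tassocV tassocV_scalable.
HB.instance Definition _ := isRScalable.Build A
  (M ⊗ (N ⊗ P)) ((M ⊗ N) ⊗ P) tassocV tassocV_rscalable.

End TensorAssoc.

Arguments tassoc {A M N P}.
Arguments tassocV {A M N P}.

Lemma bimodB (A : pzRingType) (M N : bimodType A) (f : {bimod M -> N}) x y :
  f (x - y) = f x - f y.
Proof. exact: raddfB. Qed.

Lemma tmapEr (A : pzRingType) (M N N' : bimodType A) (g : {bimod N -> N'})
  (x : M) y : tmap idfun g (pure x y) = pure x (g y).
Proof. exact: tmapE. Qed.

Lemma tmapEl (A : pzRingType) (M M' N : bimodType A) (f : {bimod M -> M'})
  x (y : N) : tmap f idfun (pure x y) = pure (f x) y.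
Proof. exact: tmapE. Qed.

Section TensorTheory.
Variable A : pzRingType.
Implicit Types L M N P Q : bimodType A.

Lemma tensor3_ind M N P (S : (M ⊗ N) ⊗ P -> Prop) :
  (forall x y z, S (pure (pure x y) z)) ->
  (forall t u, S t -> S u -> S (t - u)) -> forall t, S t.
Proof.
move=> Sp SB; elim/tensor_ind => // t z.
by elim/tensor_ind: t => // t u St Su; rewrite pureBl; exact: SB.
Qed.

Lemma tensor_ext M N L (f g : {bimod M ⊗ N -> L}) :
  (forall x y, f (pure x y) = g (pure x y)) -> f =1 g.
Proof. by move=> fg; elim/tensor_ind => // t u fgt fgu; rewrite 2!bimodB fgt fgu. Qed.

Lemma tensor3_ext M N P L (f g : {bimod (M ⊗ N) ⊗ P -> L}) :
  (forall x y z, f (pure (pure x y) z) = g (pure (pure x y) z)) -> f =1 g.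
Proof.
move=> fg; apply: tensor_ext => t z; elim/tensor_ind: t => // t u fgt fgu.
by rewrite pureBl 2!bimodB fgt fgu.
Qed.

Lemma tensor3r_ext M N P L (f g : {bimod M ⊗ (N ⊗ P) -> L}) :
  (forall x y z, f (pure x (pure y z)) = g (pure x (pure y z))) -> f =1 g.
Proof.
move=> fg; apply: tensor_ext => x t; elim/tensor_ind: t => // t u fgt fgu.
by rewrite pureBr 2!bimodB fgt fgu.
Qed.

Lemma tensor4_ext M N P Q L (f g : {bimod ((M ⊗ N) ⊗ P) ⊗ Q -> L}) :
  (forall x y z w, f (pure (pure (pure x y) z) w) =
                   g (pure (pure (pure x y) z) w)) -> f =1 g.
Proof.
move=> fg; apply: tensor3_ext => t z w; elim/tensor_ind: t => // t u fgt fgu.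
by rewrite 2!pureBl 2!bimodB fgt fgu.
Qed.

Lemma tassocK M N P : cancel (@tassoc A M N P) tassocV.
Proof.
apply: (@tensor3_ext _ _ _ _ (tassocV \o tassoc) idfun) => x y z /=.
by rewrite tassocE tassocVE.
Qed.

Lemma tassocVK M N P : cancel (@tassocV A M N P) tassoc.
Proof.
apply: (@tensor3r_ext _ _ _ _ (tassoc \o tassocV) idfun) => x y z /=.
by rewrite tassocVE tassocE.
Qed.

Lemma tmap_id M N : tmap (@idfun M) (@idfun N) =1 id.
Proof. by apply: (@tensor_ext _ _ _ (tmap idfun idfun) idfun) => x y; rewrite /= tmapE. Qed.

Lemma pentagon M N P Q :
  tmap idfun tassoc \o (tassoc \o tmap tassoc idfun) =1
  tassoc \o @tassoc A (M ⊗ N) P Q.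
Proof.
apply: (@tensor4_ext _ _ _ _ _ (tmap idfun tassoc \o (tassoc \o tmap tassoc idfun))
  (tassoc \o tassoc)) => x y z w /=.
by rewrite tmapE /= !tassocE tmapE /= tassocE.
Qed.

Lemma pentagonV M N P Q (x : M) (t : (N ⊗ P) ⊗ Q) :
  tassoc (tmap tassocV idfun (tassocV (pure x t))) =
  tassocV (pure x (tassoc t)).
Proof.
pose f : {bimod M ⊗ ((N ⊗ P) ⊗ Q) -> (M ⊗ N) ⊗ (P ⊗ Q)} :=
  tassoc \o (tmap tassocV idfun \o tassocV).
pose g : {bimod M ⊗ ((N ⊗ P) ⊗ Q) -> (M ⊗ N) ⊗ (P ⊗ Q)} :=
  tassocV \o tmap idfun tassoc.
have -> : tassocV (pure x (tassoc t)) = g (pure x t) by rewrite /= tmapE.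
rewrite -[LHS]/(f (pure x t)).
have fg y z w : f (pure x (pure (pure y z) w)) = g (pure x (pure (pure y z) w)).
  by rewrite /= tassocVE !tmapE /= tassocVE !tassocE tassocVE.
move: f g fg => f g fg; elim/tensor3_ind: t => // t u fgt fgu.
by rewrite pureBr 2!bimodB fgt fgu.
Qed.

Lemma tensor_extl M N P P' L (f : {bimod (M ⊗ N) ⊗ P -> L})
    (g : {bimod (M ⊗ N) ⊗ P' -> L}) z z' :
  (forall x y, f (pure (pure x y) z) = g (pure (pure x y) z')) ->
  forall t, f (pure t z) = g (pure t z').
Proof.
move=> fg; elim/tensor_ind => // t u fgt fgu.
by rewrite 2!pureBl 2!bimodB fgt fgu.
Qed.

Lemma tensor_extr M M' N P L (f : {bimod M ⊗ (N ⊗ P) -> L})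
    (g : {bimod M' ⊗ (N ⊗ P) -> L}) x x' :
  (forall y z, f (pure x (pure y z)) = g (pure x' (pure y z))) ->
  forall t, f (pure x t) = g (pure x' t).
Proof.
move=> fg; elim/tensor_ind => // t u fgt fgu.
by rewrite 2!pureBr 2!bimodB fgt fgu.
Qed.

Lemma tassoc_mid M N P Q (u : M ⊗ N) (v : P ⊗ Q) :
  tassoc (tmap tassoc idfun (tassocV (pure u v))) =
  tmap idfun tassocV (tassoc (pure u v)).
Proof.
move: v; apply: (tensor_extr (f := tassoc \o (tmap tassoc idfun \o tassocV))
  (g := tmap idfun tassocV \o tassoc)) => z w.
move: u; apply: (tensor_extl (f := tassoc \o (tmap tassoc idfun \o tassocV))
  (g := tmap idfun tassocV \o tassoc)) => x y.
by rewrite /= tassocVE tmapEl !tassocE tmapEr /= !tassocE tassocVE.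
Qed.

End TensorTheory.

Record aring (A : pzRingType) := ARing {
  aring_car :> bimodType A;
  aring_mul : {bimod aring_car ⊗ aring_car -> aring_car};
  aring_mulA : forall t : (aring_car ⊗ aring_car) ⊗ aring_car,
    aring_mul (tmap aring_mul idfun t) =
    aring_mul (tmap idfun aring_mul (tassoc t))
}.

Record aring_bimod (A : pzRingType) (B : aring A) := ARingBimod {
  aring_bimod_car :> bimodType A;
  lact : {bimod B ⊗ aring_bimod_car -> aring_bimod_car};
  ract : {bimod aring_bimod_car ⊗ B -> aring_bimod_car};
  lactA : forall t : (B ⊗ B) ⊗ aring_bimod_car,
    lact (tmap (@aring_mul A B) idfun t) = lact (tmap idfun lact (tassoc t));
  ractA : forall t : (aring_bimod_car ⊗ B) ⊗ B,
    ract (tmap ract idfun t) = ract (tmap idfun (@aring_mul A B) (tassoc t));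
  lractA : forall t : (B ⊗ aring_bimod_car) ⊗ B,
    ract (tmap lact idfun t) = lact (tmap idfun ract (tassoc t))
}.

Definition aring_bilinear (A : pzRingType) (B : aring A) (M N : aring_bimod B)
    (f : {bimod M -> N}) : Prop :=
  (forall t : B ⊗ M, f (lact M t) = lact N (tmap idfun f t)) /\
  (forall t : M ⊗ B, f (ract M t) = ract N (tmap f idfun t)).

Section Separable.
Variables (A : pzRingType) (B : aring A).
Notation mu := (@aring_mul A B).

Definition aring_regular : aring_bimod B :=
  @ARingBimod A B B mu mu (@aring_mulA A B) (@aring_mulA A B) (@aring_mulA A B).

Definition square_lact : {bimod B ⊗ (B ⊗ B) -> B ⊗ B} :=
  tmap mu idfun \o tassocV.

Definition square_ract : {bimod (B ⊗ B) ⊗ B -> B ⊗ B} :=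
  tmap idfun mu \o tassoc.

Lemma aring_mul_pureA (a b c : B) :
  mu (pure (mu (pure a b)) c) = mu (pure a (mu (pure b c))).
Proof. by have:= aring_mulA (pure (pure a b) c); rewrite tassocE !tmapE. Qed.

Lemma square_lactE (b x y : B) :
  square_lact (pure b (pure x y)) = pure (mu (pure b x)) y.
Proof. by rewrite /square_lact /= tassocVE tmapE. Qed.

Lemma square_ractE (x y b : B) :
  square_ract (pure (pure x y) b) = pure x (mu (pure y b)).
Proof. by rewrite /= tassocE tmapE. Qed.

Lemma square_lactA (t : (B ⊗ B) ⊗ (B ⊗ B)) :
  square_lact (tmap mu idfun t) = square_lact (tmap idfun square_lact (tassoc t)).
Proof.
move: t; apply: (@tensor_ext _ _ _ _ (square_lact \o tmap mu idfun)
  (square_lact \o (tmap idfun square_lact \o tassoc))).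
elim/tensor_ind => [a b|t u IHt IHu] v; last by rewrite pureBl 2!bimodB IHt IHu.
elim/tensor_ind: v => [x y|t u IHt IHu]; last by rewrite pureBr 2!bimodB IHt IHu.
rewrite -[LHS]/(square_lact (tmap mu idfun _))
  -[RHS]/(square_lact (tmap idfun square_lact (tassoc _))).
rewrite tassocE tmapEl tmapEr.
by rewrite !square_lactE aring_mul_pureA.
Qed.

Lemma square_ractA (t : ((B ⊗ B) ⊗ B) ⊗ B) :
  square_ract (tmap square_ract idfun t) = square_ract (tmap idfun mu (tassoc t)).
Proof.
move: t; apply: (@tensor3_ext _ _ _ _ _ (square_ract \o tmap square_ract idfun)
  (square_ract \o (tmap idfun mu \o tassoc))) => t a b.
elim/tensor_ind: t => [x y|t u IHt IHu]; last first.
  by rewrite 2!pureBl 2!bimodB IHt IHu.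
rewrite -[LHS]/(square_ract (tmap square_ract idfun _))
  -[RHS]/(square_ract (tmap idfun mu (tassoc _))).
rewrite tassocE tmapEl tmapEr.
by rewrite !square_ractE aring_mul_pureA.
Qed.

Lemma square_lractA (t : (B ⊗ (B ⊗ B)) ⊗ B) :
  square_ract (tmap square_lact idfun t) =
  square_lact (tmap idfun square_ract (tassoc t)).
Proof.
move: t; apply: (@tensor3_ext _ _ _ _ _ (square_ract \o tmap square_lact idfun)
  (square_lact \o (tmap idfun square_ract \o tassoc))) => a t b.
elim/tensor_ind: t => [x y|t u IHt IHu]; last first.
  by rewrite pureBr pureBl 2!bimodB IHt IHu.
rewrite -[LHS]/(square_ract (tmap square_lact idfun _))
  -[RHS]/(square_lact (tmap idfun square_ract (tassoc _))).
rewrite tassocE tmapEl tmapEr.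
by rewrite square_ractE square_lactE square_ractE square_lactE.
Qed.

Definition aring_square : aring_bimod B :=
  ARingBimod square_lactA square_ractA square_lractA.

Definition separable : Prop :=
  exists delta : {bimod B -> B ⊗ B},
    @aring_bilinear A B aring_regular aring_square delta /\
    forall b : B, mu (delta b) = b.

End Separable.

Definition coassociative (A : pzRingType) (M : bimodType A)
    (Delta : {bimod M -> M ⊗ M}) : Prop :=
  forall c : M, tassoc (tmap Delta idfun (Delta c)) = tmap idfun Delta (Delta c).

(* No counit: as for A-rings, which need not be unital, only                  *)
(* (co)associativity is required, also of bimodules and bicomodules.          *)
Record coring (A : pzRingType) := Coring {
  coring_car :> bimodType A;
  coprod : {bimod coring_car -> coring_car ⊗ coring_car};
  coprodA : coassociative coprod
}.

Record bicomodule (A : pzRingType) (C : coring A) := Bicomodule {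
  bicomodule_car :> bimodType A;
  lcoact : {bimod bicomodule_car -> C ⊗ bicomodule_car};
  rcoact : {bimod bicomodule_car -> bicomodule_car ⊗ C};
  lcoactA : forall m : bicomodule_car,
    tassoc (tmap (@coprod A C) idfun (lcoact m)) = tmap idfun lcoact (lcoact m);
  rcoactA : forall m : bicomodule_car,
    tassoc (tmap rcoact idfun (rcoact m)) = tmap idfun (@coprod A C) (rcoact m);
  lrcoactA : forall m : bicomodule_car,
    tassoc (tmap lcoact idfun (rcoact m)) = tmap idfun rcoact (lcoact m)
}.

Definition bicolinear (A : pzRingType) (C : coring A) (M N : bicomodule C)
    (f : {bimod M -> N}) : Prop :=
  (forall m, lcoact N (f m) = tmap idfun f (lcoact M m)) /\
  (forall m, rcoact N (f m) = tmap f idfun (rcoact M m)).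

Section Coseparable.
Variables (A : pzRingType) (C : coring A).
Notation Delta := (@coprod A C).

Definition coring_regular : bicomodule C :=
  @Bicomodule A C C Delta Delta (@coprodA A C) (@coprodA A C) (@coprodA A C).

Definition cosquare_lcoact : {bimod C ⊗ C -> C ⊗ (C ⊗ C)} :=
  tassoc \o tmap Delta idfun.

Definition cosquare_rcoact : {bimod C ⊗ C -> (C ⊗ C) ⊗ C} :=
  tassocV \o tmap idfun Delta.

Lemma cosquare_lcoactE (x y : C) :
  cosquare_lcoact (pure x y) = tassoc (pure (Delta x) y).
Proof. by rewrite /= tmapE. Qed.

Lemma cosquare_rcoactE (x y : C) :
  cosquare_rcoact (pure x y) = tassocV (pure x (Delta y)).
Proof. by rewrite /= tmapE. Qed.

Lemma cosquare_lcoactA (t : C ⊗ C) :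
  tassoc (tmap Delta idfun (cosquare_lcoact t)) =
  tmap idfun cosquare_lcoact (cosquare_lcoact t).
Proof.
move: t; apply: (@tensor_ext _ _ _ _
  (tassoc \o (tmap Delta idfun \o cosquare_lcoact))
  (tmap idfun cosquare_lcoact \o cosquare_lcoact)) => x y.
rewrite -[LHS]/(tassoc (tmap Delta idfun (cosquare_lcoact _))).
rewrite -[RHS]/(tmap idfun cosquare_lcoact (cosquare_lcoact _)).
rewrite cosquare_lcoactE.
have -> u : tmap Delta idfun (tassoc (pure u y)) =
    tassoc (pure (tmap Delta idfun u) y).
  rewrite -[pure (tmap _ _ _) _]tmapEl; move: u.
  apply: (tensor_extl (f := tmap Delta idfun \o tassoc)
    (g := tassoc \o tmap (tmap Delta idfun) idfun)) => p q.
  by rewrite /= tassocE !tmapEl /= !tmapEl tassocE.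
have -> u : tmap idfun cosquare_lcoact (tassoc (pure u y)) =
    tmap idfun tassoc (tassoc (pure (tmap idfun Delta u) y)).
  rewrite -[pure (tmap _ _ _) _]tmapEl; move: u.
  apply: (tensor_extl (f := tmap idfun cosquare_lcoact \o tassoc)
    (g := tmap idfun tassoc \o (tassoc \o tmap (tmap idfun Delta) idfun))) => p q.
  by rewrite /= tassocE tmapEr cosquare_lcoactE tmapEl /= tmapEr tassocE tmapEr.
rewrite -coprodA -[pure (tassoc _) _]tmapEl.
exact/esym/pentagon.
Qed.

Lemma cosquare_rcoactA (t : C ⊗ C) :
  tassoc (tmap cosquare_rcoact idfun (cosquare_rcoact t)) =
  tmap idfun Delta (cosquare_rcoact t).
Proof.
move: t; apply: (@tensor_ext _ _ _ _
  (tassoc \o (tmap cosquare_rcoact idfun \o cosquare_rcoact))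
  (tmap idfun Delta \o cosquare_rcoact)) => x y.
rewrite -[LHS]/(tassoc (tmap cosquare_rcoact idfun (cosquare_rcoact _))).
rewrite -[RHS]/(tmap idfun Delta (cosquare_rcoact _)).
rewrite cosquare_rcoactE.
have -> v : tmap cosquare_rcoact idfun (tassocV (pure x v)) =
    tmap tassocV idfun (tassocV (pure x (tmap Delta idfun v))).
  rewrite -[pure _ (tmap _ _ _)]tmapEr; move: v.
  apply: (tensor_extr (f := tmap cosquare_rcoact idfun \o tassocV)
    (g := tmap tassocV idfun \o (tassocV \o tmap idfun (tmap Delta idfun)))) => p q.
  by rewrite /= tassocVE tmapEl cosquare_rcoactE tmapEr /= tmapEl tassocVE tmapEl.
have -> v : tmap idfun Delta (tassocV (pure x v)) =
    tassocV (pure x (tmap idfun Delta v)).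
  rewrite -[pure _ (tmap _ _ _)]tmapEr; move: v.
  apply: (tensor_extr (f := tmap idfun Delta \o tassocV)
    (g := tassocV \o tmap idfun (tmap idfun Delta))) => p q.
  by rewrite /= tassocVE !tmapEr /= tmapEr tassocVE.
by rewrite -coprodA; exact: pentagonV.
Qed.

Lemma cosquare_lrcoactA (t : C ⊗ C) :
  tassoc (tmap cosquare_lcoact idfun (cosquare_rcoact t)) =
  tmap idfun cosquare_rcoact (cosquare_lcoact t).
Proof.
move: t; apply: (@tensor_ext _ _ _ _
  (tassoc \o (tmap cosquare_lcoact idfun \o cosquare_rcoact))
  (tmap idfun cosquare_rcoact \o cosquare_lcoact)) => x y.
rewrite -[LHS]/(tassoc (tmap cosquare_lcoact idfun (cosquare_rcoact _))).
rewrite -[RHS]/(tmap idfun cosquare_rcoact (cosquare_lcoact _)).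
rewrite cosquare_rcoactE cosquare_lcoactE.
have -> v : tmap cosquare_lcoact idfun (tassocV (pure x v)) =
    tmap tassoc idfun (tassocV (pure (Delta x) v)).
  move: v; apply: (tensor_extr (f := tmap cosquare_lcoact idfun \o tassocV)
    (g := tmap tassoc idfun \o tassocV)) => p q.
  by rewrite /= !tassocVE !tmapEl cosquare_lcoactE.
have -> u : tmap idfun cosquare_rcoact (tassoc (pure u y)) =
    tmap idfun tassocV (tassoc (pure u (Delta y))).
  move: u; apply: (tensor_extl (f := tmap idfun cosquare_rcoact \o tassoc)
    (g := tmap idfun tassocV \o tassoc)) => p q.
  by rewrite /= !tassocE !tmapEr cosquare_rcoactE.
exact: tassoc_mid.
Qed.

Definition coring_square : bicomodule C :=
  Bicomodule cosquare_lcoactA cosquare_rcoactA cosquare_lrcoactA.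

Definition coseparable : Prop :=
  exists pi : {bimod C ⊗ C -> C},
    @bicolinear A C coring_square coring_regular pi /\
    forall c : C, pi (Delta c) = c.

End Coseparable.

(* Main.v *)
(* The coproduct is the bilinear section delta of the product mu, and mu
   retracts it. Bicolinearity of mu is bilinearity of delta read backwards.
   For coassociativity write b = mu(t), t = delta(b): bilinearity gives
   delta(x y) = x delta(y) = delta(x) y, so on t = x (x) y both iterates of
   delta equal x1 (x) x2 y1 (x) y2. *)
Require Import Defs.
From mathcomp Require Import all_boot ssralg.

Set Implicit Arguments.
Unset Strict Implicit.
Unset Printing Implicit Defensive.

Section BilinearCoassociative.
Variables (A : pzRingType) (B : aring A) (delta : {bimod B -> B ⊗ B}).
Notation mu := (@aring_mul A B).
Hypothesis deltaB : @aring_bilinear A B (aring_regular B) (aring_square B) delta.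

Lemma bilinear_mull (x y : B) :
  delta (mu (pure x y)) = square_lact B (pure x (delta y)).
Proof. by have := deltaB.1 (pure x y); rewrite /= tmapEr. Qed.

Lemma bilinear_mulr (x y : B) :
  delta (mu (pure x y)) = square_ract B (pure (delta x) y).
Proof. by have := deltaB.2 (pure x y); rewrite /= tmapEl. Qed.

(** For [u = p ⊗ q], right linearity gives [delta(x p) = delta(x) p]; a term [r ⊗ s] of [delta x]
    then yields [r ⊗ s p ⊗ q] on both sides. *)
Lemma tmap_bilinear_lact (x : B) (u : B ⊗ B) :
  tassoc (tmap delta idfun (square_lact B (pure x u))) =
  tmap idfun (square_lact B) (tassoc (pure (delta x) u)).
Proof.
move: u; apply: (tensor_extr (f := tassoc \o (tmap delta idfun \o square_lact B))
  (g := tmap idfun (square_lact B) \o tassoc)) => p q.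
rewrite -[LHS]/(tassoc (tmap delta idfun (square_lact B _))).
rewrite -[RHS]/(tmap idfun (square_lact B) (tassoc _)).
rewrite square_lactE tmapEl bilinear_mulr; move: (delta x).
elim/tensor_ind => [r s|t u IHt IHu].
  by rewrite square_ractE !tassocE tmapEr square_lactE.
rewrite 2!pureBl (bimodB (square_ract B)) pureBl 3!bimodB.
by congr (_ - _)%R; [exact: IHt | exact: IHu].
Qed.

(** On [v = r ⊗ s] this is left linearity, [delta(s y) = s delta(y)]. *)
Lemma tmap_bilinear_ract (v : B ⊗ B) (y : B) :
  tmap idfun delta (square_ract B (pure v y)) =
  tmap idfun (square_lact B) (tassoc (pure v (delta y))).
Proof.
move: v; apply: (tensor_extl (f := tmap idfun delta \o square_ract B)
  (g := tmap idfun (square_lact B) \o tassoc)) => r s.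
rewrite -[LHS]/(tmap idfun delta (square_ract B _)).
rewrite -[RHS]/(tmap idfun (square_lact B) (tassoc _)).
by rewrite square_ractE tassocE !tmapEr bilinear_mull.
Qed.

Lemma bilinear_section_coassociative :
  (forall b : B, mu (delta b) = b) -> coassociative delta.
Proof.
move=> deltaK c; rewrite -[c]deltaK; move: (delta c).
apply: (@tensor_ext _ _ _ _ (tassoc \o (tmap delta idfun \o (delta \o mu)))
  (tmap idfun delta \o (delta \o mu))) => x y.
rewrite -[LHS]/(tassoc (tmap delta idfun (delta (mu _)))).
rewrite -[RHS]/(tmap idfun delta (delta (mu _))).
(* The left side expands [delta(x y)] as [x delta(y)], the right side as [delta(x) y]. *)
by rewrite {1}bilinear_mull tmap_bilinear_lact bilinear_mulr tmap_bilinear_ract.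
Qed.

End BilinearCoassociative.

Theorem proposition2p8 (A : pzRingType) (B : aring A) :
  separable B ->
  exists (Delta : {bimod B -> B ⊗ B}) (DeltaA : coassociative Delta),
    coseparable (Coring DeltaA).
Proof.
move=> [delta [deltaB deltaK]].
exists delta, (bilinear_section_coassociative deltaB deltaK).
exists (@aring_mul A B); split=> //.
(* The sides swap: left colinearity of [mu] is right linearity of [delta], and conversely. *)
by split=> [t|t]; [exact: deltaB.2 | exact: deltaB.1].
Qed.
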